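(* Let $d\ge1$ be an integer, $k=d+1$, $\boldsymbol\alpha\in\mathbb R^d$, and let $\boldsymbol\omega\in\mathcal G_{k,\ell}$, where $\ell\ge2$ is an integer. Suppose $\phi:[1,\infty)\to[1,\infty)$ is non-decreasing (and such that the function $L$ below is well defined), and that $$\|\mathbf m\cdot\boldsymbol\alpha\|<\frac1{H(\mathbf m)\,\phi(H(\mathbf m))}$$ for infinitely many $\mathbf m\in\mathbb Z^d$. Then there is a constant $c>0$, not depending on $N$, such that there exist infinitely many $N\in\mathbb N$ (with $N\ge\phi(1)$) for which $$D_{\boldsymbol\omega}(\boldsymbol\alpha;N)\ge c\,\phi(L(N)).$$
   Context: Notation. $\|x\|=\min_{a\in\mathbb Z}|x-a|$ for $x\in\mathbb R$. For $\mathbf m\in\mathbb R^d$, $H(\mathbf m)=\prod_{i\le d}\max\{1,|m_i|\}$. $e(z)=e^{2\pi i z}$ and $\widehat f(\xi)=\int_{\mathbb R}f(x)e(-\xi x)\,dx$. The function $L$. For $x\ge\phi(1)$, $L(x)\in[1,x]$ denotes the value of $H$ such that $H\phi(H)=x$. (It is unique because $H\mapsto H\phi(H)$ is strictly increasing; it is assumed that it exists for every $x\ge\phi(1)$, which is the case exactly when $\phi$ is continuous.) The class $\mathcal G_{k,\ell}$. It is the set of $\boldsymbol\omega=(\omega_1,\ldots,\omega_k)$ such that for each $i\le k$: $\omega_i:\mathbb R\to[0,\infty)$ is $\ell$ times continuously differentiable, $\mathrm{supp}(\omega_i)\subseteq[-2,2]$, $\widehat\omega_i\ge0$ everywhere,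 and $\widehat\omega_i(0)>0$. Smooth discrepancy. Put $\mathfrak C(\boldsymbol\omega)=\widehat\omega_1(0)\cdots\widehat\omega_k(0)$. A box is a pair $\mathfrak B=(\boldsymbol\gamma;\boldsymbol\rho)$ with $\boldsymbol\gamma\in\mathbb R^d$, $\boldsymbol\rho\in(0,1/2)^d$, and $\mathrm{vol}(\mathfrak B;N)=\rho_1\cdots\rho_dN$. Define $$D_{\boldsymbol\omega}(\mathfrak B;N)=\sum_{\mathbf a\in\mathbb Z^k}\omega_k\Big(\frac{a_k}{N}\Big)\prod_{i\le d}\omega_i\Big(\frac{a_i+a_k\alpha_i-\gamma_i}{\rho_i}\Big)-\mathfrak C(\boldsymbol\omega)\,\mathrm{vol}(\mathfrak B;N)$$ and $D_{\boldsymbol\omega}(\boldsymbol\alpha;N)=\sup_{\mathfrak B}|D_{\boldsymbol\omega}(\mathfrak B;N)|$, the supremum being over all boxes $\mathfrak B=(\boldsymbol\gamma;\boldsymbol\rho)$ with $\boldsymbol\gamma\in\mathbb R^d$ and $\boldsymbol\rho\in(0,1/2)^d$. *)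

(* Defs.v *)
From HB Require Import structures.
From mathcomp Require Import all_boot all_order all_algebra.
From mathcomp Require Import complex.
From mathcomp Require Import all_classical all_reals all_analysis.

Set Implicit Arguments.
Unset Strict Implicit.
Unset Printing Implicit Defensive.

Import Order.TTheory GRing.Theory Num.Theory.
Import numFieldNormedType.Exports.

Local Open Scope classical_set_scope.
Local Open Scope ring_scope.

(* Points of R^d and Z^d are row vectors, with components v 0 i. *)

(* The infimum is attained, so it is the minimum. *)
Definition dist_int {R : realType} (x : R) : R :=
  inf [set `|x - a%:~R| | a in [set: int]].

Definition height {R : realType} (d : nat) (m : 'rV[R]_d) : R :=
  \prod_(i < d) Num.max 1 `|m 0 i|.

Definition dotp {R : realType} (d : nat) (x y : 'rV[R]_d) : R :=
  \sum_(i < d) x 0 i * y 0 i.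

Definition expi {R : realType} (z : R) : R[i] :=
  (cos (2 * pi * z) +i* sin (2 * pi * z))%C.

Definition Cintegral {R : realType} (g : R -> R[i]) : R[i] :=
  (Rintegral lebesgue_measure setT (fun x => complex.Re (g x)) +i*
   Rintegral lebesgue_measure setT (fun x => complex.Im (g x)))%C.

Definition fourier {R : realType} (f : R -> R) (xi : R) : R[i] :=
  Cintegral (fun x => (f x)%:C%C * expi (- (xi * x))).

Definition Cl {R : realType} (l : nat) (f : R -> R) : Prop :=
  (forall j, (j < l)%N -> forall x, derivable (derive1n j f) x 1) /\
  continuous (derive1n l f).

(* In R[i], 0 <= z means that z is real and nonnegative. *)
Definition classG {R : realType} (k l : nat) (omega : 'I_k -> R -> R) : Prop :=
  forall i : 'I_k,
    [/\ forall x, 0 <= omega i x,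
        Cl l (omega i),
        closure [set x | omega i x != 0] `<=` `[-2, 2],
        forall xi, 0 <= fourier (omega i) xi
      & 0 < fourier (omega i) 0].

(* For omega in classG the product is a positive real number, equal to its
   real part. *)
Definition Cconst {R : realType} (k : nat) (omega : 'I_k -> R -> R) : R :=
  complex.Re (\prod_(i < k) fourier (omega i) 0).

(* A box is a pair (gamma, rho). *)
Definition boxes (R : realType) (d : nat) : set ('rV[R]_d * 'rV[R]_d) :=
  [set B : 'rV[R]_d * 'rV[R]_d | forall i : 'I_d, 0 < B.2 0 i < 2^-1].

Definition vol {R : realType} (d : nat) (B : 'rV[R]_d * 'rV[R]_d) (N : nat) : R :=
  (\prod_(i < d) B.2 0 i) * N%:R.

(* The family omega is indexed by 'I_d.+1: ord_max is the last index k = d + 1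
   and widen_ord (leqnSn d) i is the index i <= d.  For N > 0, B in boxes and
   omega in classG only finitely many terms of the sum are nonzero. *)
Definition box_discrepancy {R : realType} (d : nat) (omega : 'I_d.+1 -> R -> R)
    (alpha : 'rV[R]_d) (B : 'rV[R]_d * 'rV[R]_d) (N : nat) : R :=
  \sum_(a \in [set: 'rV[int]_d.+1])
     (omega ord_max ((a 0 ord_max)%:~R / N%:R) *
      \prod_(i < d)
        let i' := widen_ord (leqnSn d) i in
        omega i' (((a 0 i')%:~R + (a 0 ord_max)%:~R * alpha 0 i - B.1 0 i)
                  / B.2 0 i))
  - Cconst omega * vol B N.

Definition discrepancy {R : realType} (d : nat) (omega : 'I_d.+1 -> R -> R)
    (alpha : 'rV[R]_d) (N : nat) : \bar R :=
  ereal_sup [set (`|box_discrepancy omega alpha B N|)%:E | B in boxes (R:=R) (d:=d)].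

Definition is_L {R : realType} (phi : R -> R) (x H : R) : Prop :=
  1 <= H <= x /\ H * phi H = x.

(* The value is unique for phi >= 1 non-decreasing; the default value 1 is
   taken only when no suitable H exists. *)
Definition L {R : realType} (phi : R -> R) (x : R) : R :=
  xget 1 [set H | is_L phi x H].

(* Main.v *)
Require Import Defs.
From HB Require Import structures.
From mathcomp Require Import all_boot all_order all_algebra.
From mathcomp Require Import complex.
From mathcomp Require Import all_classical all_reals all_analysis.
From mathcomp Require Import zify ring lra.

Set Implicit Arguments.
Unset Strict Implicit.
Unset Printing Implicit Defensive.

Import Order.TTheory GRing.Theory Num.Theory.
Import numFieldNormedType.Exports.

Local Open Scope classical_set_scope.
Local Open Scope ring_scope.

(** The good approximations [m] produce boxes that contain no orbit point at
    all, so the discrepancy is at least the main term of such a box.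

    If [m . alpha] is very close to an integer, then for every [n] with
    [|n| <= 2N] the point [n alpha] modulo [Z^d] lies close to the union of the
    hyperplanes [m . x \in Z].  Take [gamma] with [m . gamma = 1/2], half-way
    between two of these hyperplanes, and widths [rho_i] of order
    [1 / max(1, |m_i|)], so that [m . x] varies little on the box.  Then no
    weight function sees a point, the sum over [a] vanishes, and what is left
    is [C(omega) vol(B; N)], which is comparable to [N / H(m)]
    ([box_discrepancy_empty], [vol_le_discrepancy]).

    The condition on [N] is that [N |m . alpha - j|] be small for some integer
    [j], and the hypothesis on [m] allows [N] to be a fixed fraction of
    [H(m) phi(H(m))].  Then [N / H(m)] is comparable to [phi(H(m))], and
    [L(N) <= H(m)] ([L_le]), so the bound dominates [phi(L(N))].  Only finitely
    many [m] have bounded height ([finite_height_le]), so the [N] obtained in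
    this way are unbounded. *)

Lemma half_le_norm_intBhalf (R : realType) (n : int) :
  2^-1 <= `|n%:~R - 2^-1| :> R.
Proof.
have [n0|n1] := lerP n 0.
  have h : n%:~R <= 0 :> R by rewrite lerz0.
  by rewrite ler0_norm; lra.
have h : 1 <= n%:~R :> R by rewrite ler1z.
by rewrite ger0_norm; lra.
Qed.

Lemma classG_support (R : realType) (k l : nat) (omega : 'I_k -> R -> R)
    (i : 'I_k) (x : R) :
  classG l omega -> omega i x != 0 -> `|x| <= 2.
Proof.
move=> /(_ i)[_ _ supp _ _] omegax.
have /supp : closure [set x | omega i x != 0] x by exact: subset_closure.
by rewrite /= in_itv /= ler_norml.
Qed.

Lemma Cconst_gt0 (R : realType) (k l : nat) (omega : 'I_k -> R -> R) :
  classG l omega -> 0 < Cconst omega.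
Proof.
move=> homega; rewrite /Cconst.
have : 0 < \prod_(i < k) fourier (omega i) 0.
  by apply: prodr_gt0 => i _; have [] := homega i.
by rewrite ltcE => /andP[].
Qed.

(** A lattice point [a] with a nonzero term would give an integer [n] that
    differs from [m . gamma = 1/2] by at most the left-hand side of the last
    hypothesis: its first part is the variation of [m . x] over the box, its
    second part the deviation of [a_k m . alpha] from [a_k j]. *)
Lemma box_discrepancy_empty (R : realType) (d l : nat)
    (omega : 'I_d.+1 -> R -> R) (alpha : 'rV[R]_d) (m : 'rV[int]_d) (j : int)
    (B : 'rV[R]_d * 'rV[R]_d) (N : nat) :
  classG l omega -> (0 < N)%N -> boxes B ->
  dotp (map_mx intr m) B.1 = 2^-1 ->
  2 * \sum_(i < d) `|(m 0 i)%:~R| * B.2 0 i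
    + 2 * N%:R * `|dotp (map_mx intr m) alpha - j%:~R| < 2^-1 ->
  box_discrepancy omega alpha B N = - (Cconst omega * vol B N).
Proof.
move=> homega N0 hB mid small; rewrite /box_discrepancy fsbig1 ?sub0r// => a _.
apply: contrapT => /eqP hne; move: small; apply/negP; rewrite -leNgt.
have [hk hi] : `|(a 0 ord_max)%:~R| <= 2 * N%:R :> R /\ forall i : 'I_d,
    `|(a 0 (widen_ord (leqnSn d) i))%:~R + (a 0 ord_max)%:~R * alpha 0 i
      - B.1 0 i| <= 2 * B.2 0 i.
  move: hne; rewrite mulf_eq0 negb_or => /andP[hk /prodf_neq0 hi]; split.
    have := classG_support homega hk.
    by rewrite normrM normfV normr_nat ler_pdivrMr ?ltr0n.
  move=> i; have /andP[rho0 _] := hB i.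
  have := classG_support homega (hi i isT).
  by rewrite normrM normfV (gtr0_norm rho0) ler_pdivrMr.
pose x i : R := (a 0 (widen_ord (leqnSn d) i))%:~R
  + (a 0 ord_max)%:~R * alpha 0 i - B.1 0 i.
pose n := \sum_(i < d) m 0 i * a 0 (widen_ord (leqnSn d) i) + a 0 ord_max * j.
(* m . (x + gamma) is the integer n up to a_k (m . alpha - j). *)
have key : n%:~R - 2^-1 = \sum_(i < d) (m 0 i)%:~R * x i
    - (a 0 ord_max)%:~R * (dotp (map_mx intr m) alpha - j%:~R).
  rewrite -mid /n /dotp rmorphD rmorph_sum rmorphM /= mulrBr mulr_sumr.
  under [in RHS]eq_bigr => i _ do rewrite /x mulrBr mulrDr.
  rewrite sumrB big_split /=.
  under eq_bigr => i _ do rewrite rmorphM /=.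
  under [X in _ - X = _]eq_bigr => i _ do rewrite mxE.
  under [X in _ - (X - _)]eq_bigr => i _ do rewrite mxE mulrCA.
  ring.
apply: le_trans (half_le_norm_intBhalf R n) _; rewrite key.
apply: le_trans (ler_normB _ _) _; apply: lerD.
  apply: le_trans (ler_norm_sum _ _ _) _; rewrite mulr_sumr.
  apply: ler_sum => i _; rewrite normrM mulrCA ler_wpM2l//.
  exact: hi.
by rewrite normrM ler_wpM2r.
Qed.

Lemma le_height (R : realType) (d : nat) (m : 'rV[R]_d) (i : 'I_d) :
  `|m 0 i| <= height m.
Proof.
rewrite /height (bigD1 i)//= -[leLHS]mulr1 ler_pM// ?le_max ?lexx ?orbT//.
elim/big_ind: _ => [//|x y|j _]; last by rewrite le_max lexx.
exact: mulr_ege1.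
Qed.

(** Each [|m_i|] is at most the height, since the other factors are at least
    [1]; so the set lies in the image of a cube of side [2 (trunc K) + 1]. *)
Lemma finite_height_le (R : realType) (d : nat) (K : R) :
  finite_set [set m : 'rV[int]_d | height (map_mx intr m : 'rV[R]_d) <= K].
Proof.
pose n := Num.truncn K.
pose f (v : 'rV['I_(n + n).+1]_d) : 'rV[int]_d :=
  map_mx (fun u : 'I_(n + n).+1 => u%:Z - n%:Z) v.
apply: sub_finite_set (finite_image f (finite_finset (X := setT))) => m /= hm.
have bnd i : - n%:Z <= m 0 i <= n%:Z.
  have := le_trans (le_height (map_mx intr m) i) hm.
  rewrite mxE -intr_norm -abszE => mK; rewrite -ler_norml -abszE lez_nat.
  by rewrite -[absz _](@natrK R) le_truncn.
(* Shift the coordinates by n to make them natural numbers. *)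
exists (\row_i inord (absz (m 0 i + n%:Z))) => //.
apply/matrixP => i0 i; rewrite ord1 !mxE.
have /andP[h1 h2] := bnd i.
have h : (absz (m 0 i + n%:Z))%:Z = m 0 i + n%:Z by rewrite gez0_abs//; lia.
rewrite inordK; [by rewrite h; ring|lia].
Qed.

Lemma exists_height_gt (R : realType) (d : nat) (S : set 'rV[int]_d) (K : R) :
  infinite_set S ->
  exists2 m, S m & K < height (map_mx intr m : 'rV[R]_d).
Proof.
move=> infS; apply: contrapT => hne; apply: infS.
apply: sub_finite_set (finite_height_le d K) => m Sm /=.
by rewrite leNgt; apply/negP => hm; apply: hne; exists m.
Qed.

Lemma infinite_nat_unbounded (S : set nat) :
  (forall n, exists2 N, S N & (n <= N)%N) -> infinite_set S.
Proof.
move=> unb /finite_seqP[s Ss].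
have [N SN] := unb (\sum_(i <- s) i).+1.
have {}SN : N \in s by move: SN; rewrite Ss.
by rewrite (big_rem N SN) /= ltnNge leq_addr.
Qed.

Lemma dist_int_lt (R : realType) (x e : R) :
  dist_int x < e -> exists j : int, `|x - j%:~R| < e.
Proof.
move=> /inf_lt[|_ [j _ <-] ?]; last by exists j.
by exists `|x - 0%:~R|, 0.
Qed.

(** This is the monotonicity of [H |-> H phi(H)], read off at the value
    defining [L]. *)
Lemma L_le (R : realType) (phi : R -> R) (x H : R) :
  (forall y, 1 <= y -> 1 <= phi y) ->
  (forall y z, 1 <= y -> y <= z -> phi y <= phi z) ->
  (exists H', is_L phi x H') ->
  1 <= H -> x <= H * phi H -> 1 <= L phi x <= H.
Proof.
move=> phi1 mono exH H1 xH.
have [/andP[L1 _] Lx] : is_L phi x (L phi x) by exact: xgetPex exH.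
rewrite L1 leNgt; apply/negP => HL.
have p1 := phi1 _ H1; have p2 := mono _ _ H1 (ltW HL).
have : H * phi H < L phi x * phi (L phi x).
  by nra.
lra.
Qed.

(** The box is centred at a multiple of a coordinate vector on which [m] does
    not vanish, scaled so that [m . gamma = 1/2].  The widths
    [1 / (16 d max(1, |m_i|))] and the bound on [N] make each of the two errors
    in [box_discrepancy_empty] at most [1/8], with [1/4 < 1/2] in total. *)
Lemma vol_le_discrepancy (R : realType) (d l : nat)
    (omega : 'I_d.+1 -> R -> R) (alpha : 'rV[R]_d) (m : 'rV[int]_d) (j : int)
    (N : nat) :
  (1 <= d)%N -> classG l omega -> (0 < N)%N ->
  1 < height (map_mx intr m : 'rV[R]_d) ->
  16 * N%:R * `|dotp (map_mx intr m) alpha - j%:~R| <= 1 ->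
  ((Cconst omega * ((16 * d%:R)^-1 ^+ d / height (map_mx intr m : 'rV[R]_d)
     * N%:R))%:E <= discrepancy omega alpha N)%E.
Proof.
move=> d1 homega N0 hm small.
have d0 : 1 <= d%:R :> R by rewrite ler1n.
have [i0 mi0] : exists i0, m 0 i0 != 0.
  apply: contrapT => m0; move: hm; rewrite /height big1 ?ltxx// => i _.
  rewrite mxE; case: (eqVneq (m 0 i) 0) => [->|ne]; last by case: m0; exists i.
  by rewrite normr0 max_l.
pose rho : 'rV[R]_d :=
  \row_i ((16 * d%:R)^-1 / Num.max 1 `|(m 0 i)%:~R|).
pose gamma : 'rV[R]_d := \row_i (if i == i0 then (2 * (m 0 i0)%:~R)^-1 else 0).
have max_ge1 i : 1 <= Num.max 1 `|(m 0 i)%:~R| :> R by rewrite le_max lexx.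
have max_gt0 i : 0 < Num.max 1 `|(m 0 i)%:~R| :> R.
  exact: lt_le_trans (max_ge1 i).
have c0 : 0 < (16 * d%:R)^-1 :> R by rewrite invr_gt0; lra.
have hB : boxes (gamma, rho).
  move=> i; rewrite /= mxE divr_gt0//= ltr_pdivrMr//.
  apply: (@lt_le_trans _ _ 2^-1); last by rewrite ler_peMr.
  by rewrite ltf_pV2 ?posrE; lra.
have mid : dotp (map_mx intr m) gamma = 2^-1.
  rewrite /dotp (bigD1 i0)//= big1 => [|i ne]; rewrite !mxE; last first.
    by rewrite (negPf ne) mulr0.
  by rewrite eqxx addr0; field; rewrite intr_eq0.
have slack : \sum_(i < d) `|(m 0 i)%:~R| * rho 0 i <= 16^-1.
  apply: (@le_trans _ _ (\sum_(i < d) (16 * d%:R)^-1)).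
    apply: ler_sum => i _; rewrite mxE mulrCA ler_piMr ?(ltW c0)//.
    by rewrite ler_pdivrMr// mul1r le_max lexx orbT.
  by rewrite sumr_const card_ord -[leLHS]mulr_natr invfM mulfVK//; lra.
have -> : (16 * d%:R)^-1 ^+ d / height (map_mx intr m : 'rV[R]_d) * N%:R
    = vol (gamma, rho) N.
  rewrite /vol /height /=; congr (_ * _).
  under [RHS]eq_bigr do rewrite mxE.
  rewrite big_split /= prodr_const card_ord; congr (_ * _).
  rewrite -prodfV; apply: eq_bigr => i _.
  by rewrite mxE.
apply: le_trans (ereal_sup_ubound _); last by exists (gamma, rho).
rewrite (box_discrepancy_empty homega N0 hB mid (j := j)) /=; last by lra.
by rewrite normrN lee_fin ler_norm.
Qed.

Theorem theorem1p8 (R : realType) (d l : nat) (alpha : 'rV[R]_d)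
    (omega : 'I_d.+1 -> R -> R) (phi : R -> R)
    (hd : (1 <= d)%N) (hl : (2 <= l)%N)
    (homega : classG l omega)
    (phi_ge1 : forall x, 1 <= x -> 1 <= phi x)
    (phi_mono : forall x y, 1 <= x -> x <= y -> phi x <= phi y)
    (hL : forall x, phi 1 <= x -> exists H, is_L phi x H)
    (happrox : infinite_set [set m : 'rV[int]_d |
       let mR := map_mx intr m : 'rV[R]_d in
       dist_int (dotp mR alpha) < 1 / (height mR * phi (height mR))]) :
  exists c : R, 0 < c /\
    infinite_set [set N : nat | phi 1 <= N%:R /\
      ((c * phi (L phi N%:R))%:E <= discrepancy omega alpha N)%E].
Proof.
have C0 := Cconst_gt0 homega.
have d0 : 1 <= d%:R :> R by rewrite ler1n.
have e0 : 0 < (16 * d%:R)^-1 ^+ d :> R by rewrite exprn_gt0// invr_gt0; lra.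
exists (Cconst omega * ((16 * d%:R)^-1 ^+ d * 32^-1)); split.
  by rewrite mulr_gt0// mulr_gt0.
apply: infinite_nat_unbounded => n.
have p1 := phi_ge1 1 (lexx 1).
have [m /= hm mK] := exists_height_gt (16 * (phi 1 + n%:R + 1)) happrox.
set H := height _ in hm mK.
have n0 : 0 <= n%:R :> R by [].
have H1 : 1 < H by lra.
have pH : 1 <= phi H by rewrite phi_ge1// ltW.
have HpH : H <= H * phi H by rewrite ler_peMr//; lra.
have [j hj] := dist_int_lt hm.
(* The 16 matches the hypothesis of vol_le_discrepancy, and the lower bound mK
   on H makes N at least phi 1, and at least H phi(H) / 32 after rounding. *)
pose N := Num.truncn (H * phi H / 16).
have /andP[Nle ltN] : N%:R <= H * phi H / 16 < N.+1%:R by apply: truncn_itv; lra.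
rewrite -[ltRHS]natr1 in ltN.
have N1 : phi 1 <= N%:R by lra.
exists N; last by rewrite -(ler_nat R); lra.
split=> //.
have NHp : N%:R <= H * phi H by lra.
have /andP[L1 LH] := L_le phi_ge1 phi_mono (hL _ N1) (ltW H1) NHp.
have Ngt0 : (0 < N)%N by rewrite -(ltr0n R); lra.
apply: le_trans (vol_le_discrepancy (m := m) (j := j) hd homega Ngt0 H1 _).
  rewrite lee_fin -!mulrA ler_pM2l// ler_pM2l//.
  have pL := phi_mono _ _ L1 LH.
  have : 32^-1 * phi H <= H^-1 * N%:R.
    by rewrite [leRHS]mulrC ler_pdivlMr; lra.
  lra.
have Hp0 : 0 < H * phi H by lra.
move: hj; rewrite ltr_pdivlMr// => hj.
have := ler_wpM2r (normr_ge0 (dotp (map_mx intr m) alpha - j%:~R)) Nle.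
lra.
Qed.
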